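(* Let $a_1,\dots,a_m\in\mathbb{R}^d$ and a convex polytope $\mathcal{P}\subseteq\mathbb{R}^d$ be fixed, and let $\epsilon>0$, $b_{\max}>0$. Fix a number of iterations $k\ge1$, step sizes $\alpha_1,\dots,\alpha_k>0$ and a starting point $x^{(1)}\in\mathcal{P}$, all independent of the database. Then the $\epsilon$-differentially private subgradient method, i.e. the mechanism mapping a database $D=(b_1,\dots,b_m)\in\mathbb{R}^m$ to the random output $x^{(k+1)}\in\mathbb{R}^d$, preserves $\epsilon$-differential privacy.
   Context: Databases are $D=(b_i)_{i=1}^m\in\mathbb{R}^m$; $D$ and $D'=(b_i')$ are adjacent iff $\max_i|b_i-b_i'|\le b_{\max}$. A randomized mechanism $M$ is $\epsilon$-differentially private if for all measurable subsets $\mathcal{R}$ of the output space and all adjacent $D,D'$, $\mathbb{P}(M(D)\in\mathcal{R})\le e^{\epsilon}\,\mathbb{P}(M(D')\in\mathcal{R})$. Private subgradient with parameter $\epsilon'>0$ at a point $x_0$: let $u_{\mathrm{sub}}(i;x_0)=a_i^Tx_0+b_i$ for $i\in\{1,\dots,m\}$; draw a random index $i^*\in\{1,\dots,m\}$ with $\mathbb{P}(i^*=i)\propto\exp(\epsilon' u_{\mathrm{sub}}(i;x_0)/(2b_{\max}))$; output $a_{i^*}$. The $\epsilon$-differentially private subgradient method: for $i=1,\dots,k$, let $g^{(i)}$ be a private subgradient with parameter $\epsilon'=\epsilon/k$ at the point $x^{(i)}$, drawn with fresh independent randomness (i.e., conditionally on the past, its law depends only on $x^{(i)}$ and $D$),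 and set $x^{(i+1)}=x^{(i)}-\alpha_i g^{(i)}$. The output is $x^{(k+1)}$. *)

(* Defs.v *)
From HB Require Import structures.
From mathcomp Require Import all_boot all_order all_algebra.
From mathcomp Require Import all_classical all_reals all_analysis.
From mathcomp Require Import measurable_realfun.

Set Implicit Arguments.
Unset Strict Implicit.
Unset Printing Implicit Defensive.

Import Order.TTheory GRing.Theory Num.Theory.
Import numFieldNormedType.Exports.

Local Open Scope classical_set_scope.
Local Open Scope ring_scope.

(* R^d with its Borel sigma-algebra *)
Definition borelV (R : realType) (d : nat) :=
  g_sigma_algebraType (@open 'cV[R]_d).

Definition convex_polytope (R : realType) (d : nat) (P : set 'cV[R]_d) : Prop :=
  exists (n : nat) (v : 'I_n -> 'cV[R]_d),
    P = [set x | exists w : 'I_n -> R,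
          [/\ forall i, 0 <= w i, \sum_(i < n) w i = 1
            & x = \sum_(i < n) w i *: v i]].

Definition adjacent (R : realType) (m : nat) (bmax : R) (D D' : 'cV[R]_m)
  : Prop := \big[Num.max/0]_(i < m) `|D i 0 - D' i 0| <= bmax.

(* A randomized mechanism is identified with the family of its output laws:
   M D S is the probability that the output on D falls in S. *)
Definition differentially_private (R : realType) (m : nat)
    (disp : measure_display) (T : measurableType disp)
    (bmax eps : R) (M : 'cV[R]_m -> probability T R) : Prop :=
  forall (S : set T) (D D' : 'cV[R]_m),
    measurable S -> adjacent bmax D D' ->
    (M D S <= (expR eps)%:E * M D' S)%E.

Section bind.
Context (R : realType) (d1 d2 : measure_display).
Context (T1 : measurableType d1) (T2 : measurableType d2).
Variables (mu : probability T1 R) (k : R.-pker T1 ~> T2).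
Local Open Scope ereal_scope.

(* law of Y when X has law mu and Y has conditional law k x given X = x *)
Definition pbind (A : set T2) : \bar R := \int[mu]_x k x A.

Let pbind0 : pbind set0 = 0.
Proof. by rewrite /pbind; apply: integral0_eq => x _; rewrite measure0. Qed.

Let pbind_ge0 A : 0 <= pbind A.
Proof. exact: integral_ge0. Qed.

Let pbind_sigma_additive : semi_sigma_additive pbind.
Proof.
move=> F mF tF mUF; rewrite /pbind.
under [X in _ --> X]eq_integral do rewrite measure_semi_bigcup//.
rewrite integral_nneseries//; last by move=> n; exact: measurable_kernel.
by apply: is_cvg_nneseries => n _ _; exact: integral_ge0.
Qed.

HB.instance Definition _ :=
  isMeasure.Build _ _ _ pbind pbind0 pbind_ge0 pbind_sigma_additive.

Let pbindT : pbind setT = 1.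
Proof.
rewrite /pbind; under eq_integral do rewrite prob_kernel.
rewrite integral_cst// mul1e; exact: probability_setT.
Qed.

HB.instance Definition _ := Measure_isProbability.Build _ _ _ pbind pbindT.

End bind.

Section borel.
Context (R : realType) (d : nat).

Lemma continuous_measurable_borelV (f : 'cV[R]_d -> R) :
  continuous f -> measurable_fun [set: borelV R d] (f : borelV R d -> R).
Proof.
move=> cf.
apply: (measurability _ (RGenOpens.measurableE R)).
move=> _ [_ [x [y ->]] <-]; rewrite setTI; apply: sub_sigma_algebra.
apply: open_comp; last exact: interval_open.
by move=> z _; exact: cf.
Qed.

Lemma continuous_measurable_borelVV (f : 'cV[R]_d -> 'cV[R]_d) :
  continuous f ->
  measurable_fun [set: borelV R d] (f : borelV R d -> borelV R d).
Proof.
move=> cf; apply: (@measurability _ _ (borelV R d) (borelV R d) setT f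
  (@open 'cV[R]_d) erefl).
move=> _ [U oU <-]; rewrite setTI; apply: sub_sigma_algebra.
by apply: open_comp => // z _; exact: cf.
Qed.

End borel.

Section private_subgradient.
Context (R : realType) (d m : nat).
(* indices range over 'I_m.+1: drawing an index needs at least one of them *)
Variables (a : 'I_m.+1 -> 'cV[R]_d) (bmax eps' : R) (D : 'cV[R]_m.+1).
Implicit Types (i : 'I_m.+1) (x : 'cV[R]_d).

Definition u_sub i x : R := ((a i)^T *m x) 0 0 + D i 0.

Definition index_weight x i : R := expR (eps' * u_sub i x / (2 * bmax)).

Definition index_prob x i : R := index_weight x i / \sum_j index_weight x j.

Lemma sum_index_weight_gt0 x : 0 < \sum_j index_weight x j.
Proof.
rewrite big_ord_recl ltr_pwDl ?expR_gt0//.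
by apply: sumr_ge0 => i _; exact: expR_ge0.
Qed.

Lemma index_prob_ge0 x i : 0 <= index_prob x i.
Proof. by rewrite divr_ge0 ?expR_ge0// ltW// sum_index_weight_gt0. Qed.

Lemma index_prob_sum1 x : \sum_i index_prob x i = 1.
Proof. by rewrite -mulr_suml divff// gt_eqF// sum_index_weight_gt0. Qed.

(* law of a i* when i* is drawn with probabilities index_prob x *)
Definition private_subgradient x (A : set (borelV R d)) : \bar R :=
  (\sum_(i < m.+1) (index_prob x i)%:E * \d_(a i : borelV R d) A)%E.

Section measure.
Variable x : 'cV[R]_d.
Local Open Scope ereal_scope.

Let psub0 : private_subgradient x set0 = 0.
Proof. by rewrite /private_subgradient big1// => i _; rewrite measure0 mule0. Qed.

Let psub_ge0 A : 0 <= private_subgradient x A.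
Proof. by apply: sume_ge0 => i _; rewrite mule_ge0// lee_fin index_prob_ge0. Qed.

Let psub_sigma_additive : semi_sigma_additive (private_subgradient x).
Proof.
move=> F mF tF mUF.
pose mu n := mscale (NngNum (index_prob_ge0 x (inord n)))
                    (\d_(a (inord n) : borelV R d)).
have E : private_subgradient x = msum mu m.+1.
  apply/funext => A; rewrite /private_subgradient /msum.
  by apply: eq_bigr => i _; rewrite /mu /mscale/= inord_val.
by rewrite E; exact: (@measure_semi_sigma_additive _ _ _ (msum mu m.+1)).
Qed.

HB.instance Definition _ := isMeasure.Build _ _ _
  (private_subgradient x) psub0 psub_ge0 psub_sigma_additive.

Let psubT : private_subgradient x setT = 1.
Proof.
rewrite /private_subgradient.
under eq_bigr do rewrite diracT mule1.
by rewrite sumEFin index_prob_sum1.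
Qed.

HB.instance Definition _ := Measure_isProbability.Build _ _ _
  (private_subgradient x) psubT.

End measure.

Variable alpha : R.

Lemma measurable_gradient_move x :
  measurable_fun [set: borelV R d]
    ((fun g : 'cV[R]_d => x - alpha *: g) : borelV R d -> borelV R d).
Proof.
apply: continuous_measurable_borelVV => g.
by apply: (@continuousB R _ _ (fun=> x) ( *:%R alpha));
  [exact: cst_continuous|exact: scaler_continuous].
Qed.

Lemma continuous_u_sub i : continuous (u_sub i).
Proof.
move=> x; apply: (@continuousD R _ _ (fun x => ((a i)^T *m x) 0 0) (fun=> D i 0));
  last exact: cst_continuous.
have -> : (fun x => ((a i)^T *m x) 0 0) =
    (fun x => \sum_(j < d) (a i)^T 0 j * x j 0).
  by apply/funext => y; rewrite mxE.
apply: continuous_big; first exact: add_continuous.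
move=> j _ y; apply: (@continuousM R _ (fun=> (a i)^T 0 j) (fun x => x j 0));
  [exact: cst_continuous|exact: coord_continuous].
Qed.

Lemma continuous_index_weight i : continuous (index_weight ^~ i).
Proof.
move=> x.
apply: (@continuous_comp _ _ _ (fun x => eps' * u_sub i x / (2 * bmax)) expR);
  last exact: continuous_expR.
apply: (@continuousM R _ (fun x => eps' * u_sub i x) (fun=> (2 * bmax)^-1));
  last exact: cst_continuous.
by apply: (@continuousM R _ (fun=> eps') (u_sub i));
  [exact: cst_continuous|exact: continuous_u_sub].
Qed.

Lemma measurable_index_prob i :
  measurable_fun [set: borelV R d] ((index_prob ^~ i) : borelV R d -> R).
Proof.
apply: continuous_measurable_borelV => x.
apply: (@continuousM R _ (index_weight ^~ i)
  (fun x => (\sum_j index_weight x j)^-1)); first exact: continuous_index_weight.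
apply: (@continuousV R _ (fun x => \sum_j index_weight x j)).
  by rewrite gt_eqF// sum_index_weight_gt0.
apply: continuous_big; first exact: add_continuous.
by move=> j _; exact: continuous_index_weight.
Qed.

(* law of x - alpha g when g is a private subgradient at x *)
Definition subgradient_step (x : 'cV[R]_d) : set (borelV R d) -> \bar R :=
  pushforward (private_subgradient x)
    ((fun g : 'cV[R]_d => x - alpha *: g) : borelV R d -> borelV R d).

Section measure.
Variable x : 'cV[R]_d.
Local Open Scope ereal_scope.

Let step0 : subgradient_step x set0 = 0.
Proof. by rewrite /subgradient_step /pushforward preimage_set0 measure0. Qed.

Let step_ge0 A : 0 <= subgradient_step x A.
Proof. by apply: sume_ge0 => i _; rewrite mule_ge0// lee_fin index_prob_ge0. Qed.

Let step_sigma_additive : semi_sigma_additive (subgradient_step x).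
Proof.
move=> F mF tF mUF.
rewrite /subgradient_step /pushforward preimage_bigcup.
have mpre (A : set (borelV R d)) : measurable A -> measurable
    (((fun g : 'cV[R]_d => x - alpha *: g)%R : borelV R d -> borelV R d)
      @^-1` A).
  by move=> mA; rewrite -[X in measurable X]setTI; exact: measurable_gradient_move.
apply: measure_semi_sigma_additive.
- by move=> n; exact: mpre.
- apply/trivIsetP => /= i j _ _ ij; rewrite -preimage_setI.
  by move/trivIsetP : tF => /(_ _ _ _ _ ij) ->//; rewrite preimage_set0.
- by rewrite -preimage_bigcup; exact: mpre.
Qed.

HB.instance Definition _ := isMeasure.Build _ _ _
  (subgradient_step x) step0 step_ge0 step_sigma_additive.

End measure.

Definition step_kernel (x : borelV R d)
  : {measure set (borelV R d) -> \bar R} := subgradient_step x.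

Let measurable_step_kernel U : measurable U ->
  measurable_fun [set: borelV R d] (step_kernel ^~ U).
Proof.
move=> mU; apply: emeasurable_sum => i.
apply: emeasurable_funM.
  by apply/measurable_EFinP; exact: measurable_index_prob.
rewrite (_ : (fun _ => _) = (fun x : borelV R d =>
  \d_((x : 'cV[R]_d) - alpha *: a i : borelV R d) U)); last first.
  by apply/funext => x; rewrite !diracE.
under eq_fun do rewrite diracE.
apply/measurable_EFinP.
have mf : measurable_fun [set: borelV R d]
    ((fun x : 'cV[R]_d => x - alpha *: a i) : borelV R d -> borelV R d).
  apply: continuous_measurable_borelVV => x.
  by apply: (@continuousB R _ _ id (fun=> alpha *: a i));
    [exact: cvg_id|exact: cst_continuous].
exact: (measurableT_comp (measurable_indic mU) mf).
Qed.

HB.instance Definition _ :=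
  isKernel.Build _ _ _ _ R step_kernel measurable_step_kernel.

Let step_kernelT x : step_kernel x setT = 1%E.
Proof.
by rewrite /step_kernel /= /subgradient_step /pushforward preimage_setT
  probability_setT.
Qed.

HB.instance Definition _ :=
  Kernel_isProbability.Build _ _ _ _ R step_kernel step_kernelT.

End private_subgradient.

Section private_subgradient_method.
Context (R : realType) (d m : nat).
Variables (a : 'I_m.+1 -> 'cV[R]_d) (bmax eps : R).
Variables (k : nat) (alpha : nat -> R) (x1 : 'cV[R]_d).

(* law of the iterate x^(n.+1), with steps alpha 1, ..., alpha n *)
Fixpoint iterate_law (D : 'cV[R]_m.+1) (n : nat) : probability (borelV R d) R :=
  match n with
  | 0 => \d_(x1 : borelV R d)
  | n'.+1 => pbind (iterate_law D n')
                   (step_kernel a bmax (eps / k%:R) D (alpha n'.+1))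
  end.

Definition private_subgradient_method (D : 'cV[R]_m.+1)
  : probability (borelV R d) R := iterate_law D k.

End private_subgradient_method.

(* Main.v *)
Require Import Defs.
From mathcomp Require Import all_boot all_order all_algebra.
From mathcomp Require Import all_classical all_reals all_analysis.
From mathcomp Require Import measurable_realfun ring lra.

Import Order.TTheory GRing.Theory Num.Theory.
Import numFieldNormedType.Exports.

Local Open Scope classical_set_scope.
Local Open Scope ring_scope.

(** Passing to an adjacent database changes each score by at most [bmax], hence
each unnormalised weight by a factor at most [expR (eps' / 2)], and so does the
normalising sum; each index probability thus changes by a factor at most
[expR eps'].  Conditionally on the current iterate, a step is a post-processing
of such a draw, and multiplicative bounds on laws and on kernels multiply under
integration.  With [eps' = eps / k], after [k] steps the factor is [expR eps]. *)

Lemma adjacent_sym (R : realType) (m : nat) (bmax : R) (D D' : 'cV[R]_m) :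
  Defs.adjacent bmax D D' -> Defs.adjacent bmax D' D.
Proof.
by rewrite /Defs.adjacent; under eq_bigr do rewrite distrC.
Qed.

Lemma adjacent_coord (R : realType) (m : nat) (bmax : R) (D D' : 'cV[R]_m) i :
  Defs.adjacent bmax D D' -> D i 0 - D' i 0 <= bmax.
Proof.
move=> adj; apply: le_trans (ler_norm _) _; apply: le_trans adj.
exact: (le_bigmax _ (fun i => `|D i 0 - D' i 0|)).
Qed.

Section exponential_mechanism.
Context (R : realType) (d m : nat) (a : 'I_m.+1 -> 'cV[R]_d) (bmax eps' : R).
Hypotheses (bmax_gt0 : 0 < bmax) (eps'_ge0 : 0 <= eps').
Implicit Types (D : 'cV[R]_m.+1) (x : 'cV[R]_d).

Lemma index_weight_adjacent D D' x i : Defs.adjacent bmax D D' ->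
  index_weight a bmax eps' D x i
    <= expR (eps' / 2) * index_weight a bmax eps' D' x i.
Proof.
move=> adj; rewrite /index_weight -expRD ler_expR.
(* The factor [expR (eps' / 2)] amounts to raising the score by exactly [bmax]. *)
have -> : eps' / 2 + eps' * u_sub a D' i x / (2 * bmax) =
    eps' * (bmax + u_sub a D' i x) / (2 * bmax).
  by field; rewrite gt_eqF.
rewrite ler_pM2r ?invr_gt0 ?mulr_gt0// ler_wpM2l// /u_sub.
by have := @adjacent_coord _ _ _ _ _ i adj; lra.
Qed.

Lemma index_prob_adjacent D D' x i : Defs.adjacent bmax D D' ->
  index_prob a bmax eps' D x i <= expR eps' * index_prob a bmax eps' D' x i.
Proof.
move=> adj; rewrite /index_prob mulrA.
rewrite ler_pdivrMr ?sum_index_weight_gt0// mulrAC.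
rewrite ler_pdivlMr ?sum_index_weight_gt0//.
(* After cross-multiplication, one half pays for the weight, from [D] to [D'], the other for the
   normalising sum, from [D'] to [D]. *)
have -> : expR eps' = expR (eps' / 2) * expR (eps' / 2) :> R.
  by rewrite -expRD -splitr.
rewrite [leRHS](_ : _ = (expR (eps' / 2) * index_weight a bmax eps' D' x i) *
  (expR (eps' / 2) * \sum_j index_weight a bmax eps' D x j)); last by ring.
apply: ler_pM; rewrite ?expR_ge0 ?(ltW (sum_index_weight_gt0 _ _ _ _ _))//.
  exact: index_weight_adjacent.
rewrite mulr_sumr; apply: ler_sum => j _.
exact/index_weight_adjacent/adjacent_sym.
Qed.

(** Only the mixture weights depend on the database, not the Dirac masses, so the bound holds term
    by term. *)
Lemma step_kernel_adjacent D D' alpha (x : borelV R d) (S : set (borelV R d)) :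
  Defs.adjacent bmax D D' ->
  (step_kernel a bmax eps' D alpha x S
    <= (expR eps')%:E * step_kernel a bmax eps' D' alpha x S)%E.
Proof.
move=> adj; rewrite /step_kernel /= /subgradient_step /pushforward.
rewrite /private_subgradient ge0_sume_distrr; last first.
  by move=> i _; rewrite mule_ge0// lee_fin index_prob_ge0.
apply: lee_sum => i _; rewrite muleA lee_wpmul2r// -EFinM lee_fin.
exact: index_prob_adjacent.
Qed.

End exponential_mechanism.

Lemma le_pbind (R : realType) (d1 d2 : measure_display)
    (T1 : measurableType d1) (T2 : measurableType d2)
    (mu mu' : probability T1 R) (k k' : R.-pker T1 ~> T2) (c c' : R)
    (S : set T2) : 0 <= c -> 0 <= c' -> measurable S ->
  (forall A, measurable A -> mu A <= c%:E * mu' A)%E ->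
  (forall x, k x S <= c'%:E * k' x S)%E ->
  (pbind mu k S <= (c * c')%:E * pbind mu' k' S)%E.
Proof.
move=> c0 c'0 mS lemu lek; rewrite /pbind.
have mk' : measurable_fun [set: T1] (k' ^~ S) by exact: measurable_kernel.
have mck' : measurable_fun [set: T1] (fun x => c'%:E * k' x S)%E.
  exact: measurable_funeM.
(* The kernel is replaced first, under a fixed [mu]; the measure is replaced next, with [c * mu']
   taken as a measure dominating [mu]. *)
apply: (@le_trans _ _ (\int[mu]_x (c'%:E * k' x S))%E).
  by apply: ge0_le_integral => //; exact: measurable_kernel.
apply: (@le_trans _ _ (\int[mscale (NngNum c0) mu']_x (c'%:E * k' x S))%E).
  by apply: ge0_le_measure_integral => // x; rewrite mule_ge0.
rewrite ge0_integral_mscale//; last by move=> x _; rewrite mule_ge0.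
by rewrite ge0_integralZl_EFin// muleA -EFinM.
Qed.

Lemma iterate_law_adjacent (R : realType) (d m : nat)
    (a : 'I_m.+1 -> 'cV[R]_d) (eps bmax : R) (k : nat) (alpha : nat -> R)
    (x1 : 'cV[R]_d) (D D' : 'cV[R]_m.+1) (n : nat) (S : set (borelV R d)) :
  0 <= eps -> 0 < bmax -> Defs.adjacent bmax D D' -> measurable S ->
  (iterate_law a bmax eps k alpha x1 D n S
    <= (expR (eps / k%:R) ^+ n)%:E
       * iterate_law a bmax eps k alpha x1 D' n S)%E.
Proof.
(* [S] stays general because [le_pbind] compares the laws of the previous iterate on all measurable
   sets. At [n = 0] both laws are the Dirac mass at [x1]. *)
move=> eps0 bmax0 adj; elim: n S => [S _|n IH S mS].
  by rewrite expr0 mul1e.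
rewrite exprSr; apply: le_pbind => //; rewrite ?exprn_ge0 ?expR_ge0// => x.
by apply: step_kernel_adjacent => //; rewrite divr_ge0.
Qed.

Theorem mainTheorem6 (R : realType) (d m : nat) (a : 'I_m.+1 -> 'cV[R]_d)
    (P : set 'cV[R]_d) (eps bmax : R) (k : nat) (alpha : nat -> R)
    (x1 : 'cV[R]_d)
    (hP : convex_polytope P) (heps : 0 < eps) (hbmax : 0 < bmax)
    (hk : (1 <= k)%N) (halpha : forall i : nat, (1 <= i <= k)%N -> 0 < alpha i)
    (hx1 : P x1) :
  differentially_private bmax eps
    (private_subgradient_method a bmax eps k alpha x1).
Proof.
move=> S D D' mS adj; rewrite /private_subgradient_method.
(* The [k] equal shares add up to [eps] since [k] is nonzero. *)
have -> : expR eps = expR (eps / k%:R) ^+ k.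
  by rewrite -expRM_natr divfK// pnatr_eq0 -lt0n.
by apply: iterate_law_adjacent => //; exact: ltW.
Qed.
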